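(* Let $\mathfrak{B}$ be a bornology on a metric space $X$ with a closed base. Let $\mathcal{I}_1,\mathcal{I}_2,\mathcal{J}_1,\mathcal{J}_2$ be ideals on $\omega$ with $\mathcal{I}_1\leq_{K}\mathcal{I}_2$ and $\mathcal{J}_1\leq_{KB}\mathcal{J}_2$. If $X$ satisfies $\mathrm{S}_1(\mathcal{I}_2\text{-}\Gamma_{\mathfrak{B}^s},\mathcal{J}_1\text{-}\Gamma_{\mathfrak{B}^s})$, then $X$ satisfies $\mathrm{S}_1(\mathcal{I}_1\text{-}\Gamma_{\mathfrak{B}^s},\mathcal{J}_2\text{-}\Gamma_{\mathfrak{B}^s})$.
   Context: $(X,d)$ is an infinite metric space; $\omega$ is the set of natural numbers. A bornology $\mathfrak{B}$ on $X$ is a family of subsets of $X$ that is closed under subsets and finite unions and covers $X$. A base of $\mathfrak{B}$ is a subfamily $\mathfrak{B}_0\subseteq\mathfrak{B}$ such that every $B\in\mathfrak{B}$ is contained in some $B_0\in\mathfrak{B}_0$; it is a closed base if its members are closed. For $B\in\mathfrak{B}$, $\delta>0$: $B^\delta=\bigcup_{x\in B}\{y\in X:d(x,y)<\delta\}$. An ideal on $\omega$ is a family $\mathcal{I}\subseteq\mathcal{P}(\omega)$ closed under subsets and finite unions, containing all finite sets, with $\omega\notin\mathcal{I}$. For ideals $\mathcal{I},\mathcal{J}$: $\mathcal{I}\leq_{K}\mathcal{J}$ means there is a function $\phi:\omega\to\omega$ with $\phi^{-1}(A)\in\mathcal{J}$ for all $A\in\mathcal{I}$; $\mathcal{I}\leq_{KB}\mathcal{J}$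 means there is such a $\phi$ that is finite-to-one. Covers of $X$ never contain $X$ as an element. A countable open cover $\{U_n:n\in\omega\}$ (with its enumeration) is an $\mathcal{I}$-$\gamma_{\mathfrak{B}^s}$-cover if for each $B\in\mathfrak{B}$ there is a sequence $\{\delta_n\}$ of positive reals with $\{n\in\omega:B^{\delta_n}\nsubseteq U_n\}\in\mathcal{I}$; $\mathcal{I}\text{-}\Gamma_{\mathfrak{B}^s}$ is the class of these. $\mathrm{S}_1(\mathcal{A},\mathcal{B})$: for every sequence $\{A_n:n\in\omega\}$ of elements of $\mathcal{A}$ there are $a_n\in A_n$ ($n\in\omega$) such that $\{a_n:n\in\omega\}\in\mathcal{B}$ (for enumerated covers, with the enumeration $n\mapsto a_n$). *)

(* Defs.v *)
From mathcomp Require Import all_boot all_order all_algebra.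
From mathcomp Require Import all_classical all_reals all_analysis.

Set Implicit Arguments.
Unset Strict Implicit.
Unset Printing Implicit Defensive.

Import Order.TTheory GRing.Theory Num.Theory.
Import numFieldNormedType.Exports.

Local Open Scope classical_set_scope.
Local Open Scope ring_scope.

Definition bornology (X : Type) (BB : set (set X)) : Prop :=
  [/\ forall A B : set X, A `<=` B -> BB B -> BB A,
      forall A B : set X, BB A -> BB B -> BB (A `|` B)
    & \bigcup_(B in BB) B = setT].

Definition bornology_base (X : Type) (BB BB0 : set (set X)) : Prop :=
  BB0 `<=` BB /\ forall B, BB B -> exists2 B0, BB0 B0 & B `<=` B0.

Definition has_closed_base (X : topologicalType) (BB : set (set X)) : Prop :=
  exists BB0 : set (set X),
    bornology_base BB BB0 /\ forall B, BB0 B -> closed B.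

Definition enlargement (R : realType) (X : metricType R) (B : set X)
    (delta : R) : set X :=
  \bigcup_(x in B) [set y | mdist x y < delta].

Definition omega_ideal (I : set (set nat)) : Prop :=
  [/\ forall A B : set nat, A `<=` B -> I B -> I A,
      forall A B : set nat, I A -> I B -> I (A `|` B),
      forall A : set nat, finite_set A -> I A
    & ~ I setT].

Definition finite_to_one (phi : nat -> nat) : Prop :=
  forall n : nat, finite_set (phi @^-1` [set n]).

Definition katetov_le (I J : set (set nat)) : Prop :=
  exists phi : nat -> nat, forall A, I A -> J (phi @^-1` A).

Definition katetov_blass_le (I J : set (set nat)) : Prop :=
  exists2 phi : nat -> nat,
    finite_to_one phi & forall A, I A -> J (phi @^-1` A).

(* A countable cover comes with its enumeration [U : nat -> set X], which may
   repeat members. *)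
Definition enum_open_cover (X : topologicalType) (U : nat -> set X) : Prop :=
  [/\ forall n, open (U n), forall n, U n <> setT & cover setT U = setT].

(* The class I-Gamma_{BB^s} of I-gamma_{BB^s}-covers. *)
Definition ideal_Gamma_s (R : realType) (X : metricType R)
    (BB : set (set X)) (I : set (set nat)) : set (nat -> set X) :=
  [set U | enum_open_cover U /\
    forall B, BB B ->
      exists delta : nat -> R, (forall n, 0 < delta n) /\
        I [set n | ~ (enlargement B (delta n) `<=` U n)]].

(* S_1 for classes of enumerated families: the selection [a] is enumerated by
   the index of the family it is taken from. *)
Definition S1 (X : Type) (CA CB : set (nat -> set X)) : Prop :=
  forall U : nat -> nat -> set X, (forall n, CA (U n)) ->
    exists a : nat -> set X, (forall n, range (U n) (a n)) /\ CB a.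

(* Main.v *)
Require Import Defs.
From mathcomp Require Import all_boot all_order all_algebra.
From mathcomp Require Import all_classical all_reals all_analysis.

(** Call [n] bad for [B] if [B^(delta n)] is not inside the [n]-th set.

    A map [phi] witnessing [I1 <=_K I2] turns an [I1]-cover [U] into the
    [I2]-cover [U \o phi], since the bad indices of [U \o phi] are the preimage
    of those of [U] ([ideal_Gamma_s_comp]).

    Let [psi] be a finite-to-one witness of [J1 <=_KB J2].  A [J1]-good
    selection [b] should give the [J2]-good selection [b \o psi], but [b (psi n)]
    is taken from the family number [psi n] and not from the [n]-th one.  Hence
    the selection principle is applied to families [V k] which refine, term by
    term, all the [U n \o phi] with [psi n = k].  There are finitely many such
    [n], and pointwise finite intersections of covers of this kind are again of
    this kind ([ideal_Gamma_s_refine]).  If [V k (m k)] is the selected member,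
    then [U n (phi (m (psi n)))] belongs to the [n]-th family and contains the
    selected member number [psi n], so the bad [n] lie in the [psi]-preimage
    of a member of [J1]. *)

Set Implicit Arguments.
Unset Strict Implicit.
Unset Printing Implicit Defensive.

Import Order.TTheory.

Local Open Scope classical_set_scope.
Local Open Scope ring_scope.

Lemma enlargement_sub (R : realType) (X : metricType R) (B : set X)
    (d e : R) : d <= e -> enlargement B d `<=` enlargement B e.
Proof. by move=> de y [x Bx /= xy]; exists x => //=; exact: lt_le_trans xy de. Qed.

(** The covering property is automatic: a point [x] lies in some [B] of the
    bornology, and as [nat] is not in the ideal some index is good for [B]. *)
Lemma ideal_Gamma_s_intro (R : realType) (X : metricType R)
    (BB : set (set X)) (I : set (set nat)) (U : nat -> set X) :
  bornology BB -> omega_ideal I ->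
  (forall n, open (U n)) -> (forall n, U n <> setT) ->
  (forall B, BB B -> exists delta : nat -> R, (forall n, 0 < delta n) /\
     I [set n | ~ (enlargement B (delta n) `<=` U n)]) ->
  ideal_Gamma_s BB I U.
Proof.
move=> [_ _ BBcover] [_ _ _ InT] Uopen Uproper Ugood; split=> //; split=> //.
rewrite -subTset => x _.
have [B BB_B Bx] : (\bigcup_(B in BB) B) x by rewrite BBcover.
have [delta [delta_gt0 Ibad]] := Ugood B BB_B.
apply: contrapT => xnU; apply: InT.
suff <- : [set n | ~ (enlargement B (delta n) `<=` U n)] = setT by [].
rewrite -subTset => n _ /= BU; apply: xnU; exists n => //; apply: BU.
by exists x => //=; rewrite mdistxx.
Qed.

Lemma ideal_Gamma_s_comp (R : realType) (X : metricType R)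
    (BB : set (set X)) (I J : set (set nat)) (phi : nat -> nat)
    (U : nat -> set X) :
  bornology BB -> omega_ideal J -> (forall A, I A -> J (phi @^-1` A)) ->
  ideal_Gamma_s BB I U -> ideal_Gamma_s BB J (U \o phi).
Proof.
move=> bornBB Jideal phiIJ [[Uopen Uproper _] Ugood].
apply: ideal_Gamma_s_intro => // [n|n|B /Ugood[delta [delta_gt0 Ibad]]].
- exact: Uopen.
- exact: Uproper.
- by exists (delta \o phi); split=> [n|]; [exact: delta_gt0|exact: phiIJ _ Ibad].
Qed.

(** With the smaller of the two radii, an index bad for the intersection is bad
    for one of the two covers. *)
Lemma ideal_Gamma_s_setI (R : realType) (X : metricType R)
    (BB : set (set X)) (I : set (set nat)) (U V : nat -> set X) :
  bornology BB -> omega_ideal I ->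
  ideal_Gamma_s BB I U -> ideal_Gamma_s BB I V ->
  ideal_Gamma_s BB I (fun n => U n `&` V n).
Proof.
move=> bornBB Iideal [[Uopen Uproper _] Ugood] [[Vopen _ _] Vgood].
have [Isub IU _ _] := Iideal.
apply: ideal_Gamma_s_intro => // [n|n UV|B BB_B].
- exact: openI.
- by apply: (Uproper n); rewrite -subTset -UV => x [].
have [d [d_gt0 Id]] := Ugood B BB_B; have [e [e_gt0 Ie]] := Vgood B BB_B.
exists (fun n => Order.min (d n) (e n)); split=> [n|].
  by rewrite lt_min d_gt0 e_gt0.
apply: Isub (IU _ _ Id Ie) => n /= bad.
apply: contrapT => /not_orP[/contrapT BU /contrapT BV]; apply: bad => y By.
split; [apply: BU|apply: BV]; apply: enlargement_sub By.
  by rewrite ge_min lexx.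
by rewrite ge_min lexx orbT.
Qed.

Lemma ideal_Gamma_s_refine (R : realType) (X : metricType R)
    (BB : set (set X)) (I : set (set nat)) (U : nat -> nat -> set X)
    (F : set nat) :
  bornology BB -> omega_ideal I -> finite_set F ->
  (forall n, ideal_Gamma_s BB I (U n)) ->
  exists2 V, ideal_Gamma_s BB I V & forall n m, F n -> V m `<=` U n m.
Proof.
move=> bornBB Iideal /finite_seqP[s ->] UG.
elim: s => [|k s [V VG VU]].
  (* The empty intersection would be [setT], which is not allowed in a cover;
     any of the given covers does instead. *)
  by exists (U 0%N).
exists (fun m => U k m `&` V m); first exact: ideal_Gamma_s_setI.
move=> n m /=; rewrite inE => /orP[/eqP ->|ns] x [Ux Vx] //.
exact: (VU n m ns).
Qed.

Theorem theorem3p6 (R : realType) (X : metricType R)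
    (X_infinite : infinite_set [set: X])
    (BB : set (set X)) (BB_bornology : bornology BB)
    (BB_closed_base : has_closed_base BB)
    (I1 I2 J1 J2 : set (set nat))
    (I1_ideal : omega_ideal I1) (I2_ideal : omega_ideal I2)
    (J1_ideal : omega_ideal J1) (J2_ideal : omega_ideal J2)
    (I1_le_I2 : katetov_le I1 I2) (J1_le_J2 : katetov_blass_le J1 J2) :
  S1 (ideal_Gamma_s BB I2) (ideal_Gamma_s BB J1) ->
  S1 (ideal_Gamma_s BB I1) (ideal_Gamma_s BB J2).
Proof.
move=> S1X U UG.
have [phi phiI] := I1_le_I2; have [psi psi_fin psiJ] := J1_le_J2.
have /choice[V VP] : forall k, exists V, ideal_Gamma_s BB I2 V /\
    forall n m, psi n = k -> V m `<=` U n (phi m).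
  move=> k.
  have [|V VG VU] := @ideal_Gamma_s_refine R X BB I2 (fun n => U n \o phi)
      (psi @^-1` [set k]) BB_bornology I2_ideal (psi_fin k).
    by move=> n; exact: ideal_Gamma_s_comp (UG n).
  by exists V; split.
have [b [bV [_ bgood]]] := S1X V (fun k => (VP k).1).
have /choice[m bE] : forall k, exists m, V k m = b k.
  by move=> k; have [m _ <-] := bV k; exists m.
exists (fun n => U n (phi (m (psi n)))); split.
  by move=> n; exists (phi (m (psi n))).
have [J2sub _ _ _] := J2_ideal.
apply: ideal_Gamma_s_intro => // [n|n|B /bgood[delta [delta_gt0 Jbad]]].
- by have [[Uopen _ _] _] := UG n; exact: Uopen.
- by have [[_ Uproper _] _] := UG n; exact: Uproper.
exists (delta \o psi); split=> [n|]; first exact: delta_gt0.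
apply: J2sub (psiJ _ Jbad) => n /= bad Bb; apply: bad.
apply: subset_trans Bb _; rewrite -bE; exact: (VP (psi n)).2.
Qed.
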